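(* Let $Q\in\mathbb{S}^n$ and let $\mathcal{F}$ be any subset of $\mathbb{R}^n\times\mathbb{S}^n$. Define, with values in $[-\infty,+\infty]$, $$p^*_{\mathrm{LSDP}}:=\sup\{\operatorname{trace}(QX) : (x,X)\in\mathcal{F},\ X-xx^T\succeq 0\},$$ and, for every $Q_p\in\mathbb{S}^n$ with $Q-Q_p\preceq 0$, $$p^*_{\mathrm{QSDP}_{Q_p}}:=\sup\{x^T(Q-Q_p)x+\operatorname{trace}(Q_pX) : (x,X)\in\mathcal{F},\ X-xx^T\succeq 0\}.$$ Then for any choice of matrix $Q_p\in\mathbb{S}^n$ satisfying $Q-Q_p\preceq 0$ we have $$p^*_{\mathrm{QSDP}_{Q_p}}\ \geq\ p^*_{\mathrm{LSDP}}.$$ Moreover, $$\inf\{p^*_{\mathrm{QSDP}_{Q_p}} : Q_p\in\mathbb{S}^n,\ Q-Q_p\preceq 0\}=p^*_{\mathrm{LSDP}}.$$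
   Context: $\mathbb{S}^n$ is the space of real symmetric $n\times n$ matrices. For $A\in\mathbb{S}^n$, $A\succeq 0$ (resp. $A\preceq 0$) means that $A$ is positive (resp. negative) semidefinite. The supremum over the empty set is $-\infty$. The set $\mathcal{F}$ is not required to be convex or bounded. *)

(* Defs.v *)
From mathcomp Require Import all_boot all_order all_algebra.
From mathcomp Require Import all_classical all_reals all_analysis.

Set Implicit Arguments.
Unset Strict Implicit.
Unset Printing Implicit Defensive.

Import Order.TTheory GRing.Theory Num.Theory.

Local Open Scope classical_set_scope.
Local Open Scope ring_scope.

Definition qform (R : realType) (n : nat) (A : 'M[R]_n) (x : 'cV[R]_n) : R :=
  (x^T *m A *m x) 0 0.

Definition psdmx (R : realType) (n : nat) (A : 'M[R]_n) : Prop :=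
  A \is symmetricmx /\ forall x : 'cV[R]_n, 0 <= qform A x.

Definition nsdmx (R : realType) (n : nat) (A : 'M[R]_n) : Prop :=
  A \is symmetricmx /\ forall x : 'cV[R]_n, qform A x <= 0.

Definition sdp_feasible (R : realType) (n : nat)
    (F : set ('cV[R]_n * 'M[R]_n)) : set ('cV[R]_n * 'M[R]_n) :=
  [set p | F p /\ psdmx (p.2 - p.1 *m p.1^T)].

(* [ereal_sup] takes the value [-oo] on the empty set, which is the optimal
   value of an infeasible problem. *)
Definition p_LSDP (R : realType) (n : nat) (Q : 'M[R]_n)
    (F : set ('cV[R]_n * 'M[R]_n)) : \bar R :=
  ereal_sup [set (\tr (Q *m p.2))%:E | p in sdp_feasible F].

(* Total in [Qp]; only meaningful when [nsdmx (Q - Qp)]. *)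
Definition p_QSDP (R : realType) (n : nat) (Q : 'M[R]_n)
    (F : set ('cV[R]_n * 'M[R]_n)) (Qp : 'M[R]_n) : \bar R :=
  ereal_sup [set (qform (Q - Qp) p.1 + \tr (Qp *m p.2))%:E
            | p in sdp_feasible F].

Definition qsdp_param (R : realType) (n : nat) (Q : 'M[R]_n) : set 'M[R]_n :=
  [set Qp | Qp \is symmetricmx /\ nsdmx (Q - Qp)].

(* Main.v *)
Require Import Defs.
From mathcomp Require Import all_boot all_order all_algebra.
From mathcomp Require Import all_classical all_reals all_analysis.
From mathcomp Require Import ring.

Import Order.TTheory GRing.Theory Num.Theory.

Local Open Scope classical_set_scope.
Local Open Scope ring_scope.

(** The two objectives differ by a term of constant sign.  On a feasible pair
    (x, X), write N = Q - Qp, which is negative semidefinite, and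
    Y = X - x x^T, which is positive semidefinite; then

      x^T N x + tr (Qp X) = tr (Q X) - tr (N Y).

    The trace of a product of two positive semidefinite matrices is
    nonnegative ([psdmx_trace_mul_ge0]), so tr (N Y) <= 0 and the quadratic
    objective dominates the linear one pointwise, hence so do the suprema.
    Taking Qp = Q is allowed and makes N = 0: the two problems then coincide,
    so the infimum over Qp is attained there.

    The trace inequality follows from writing Y as a sum of squares v v^T
    ([psdmx_sum_outer]), since tr (P v v^T) = v^T P v.  That decomposition is
    obtained by elimination rather than from eigenvalues: subtracting
    from Y the square of a suitably scaled column leaves a positive
    semidefinite matrix with at least one more zero on the diagonal. *)

Lemma symmetricmxP (R : realType) (n : nat) (A : 'M[R]_n) :
  A \is symmetricmx <-> A^T = A.
Proof.
rewrite is_hermitianmxE expr0 scale1r map_mx_id; split=> [/eqP /esym //|->].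
exact: eqxx.
Qed.

Lemma symmetric_bilinC (R : realType) (n : nat) (A : 'M[R]_n)
    (u v : 'cV[R]_n) : A \is symmetricmx ->
  (u^T *m A *m v) 0 0 = (v^T *m A *m u) 0 0.
Proof.
move=> /symmetricmxP symA; rewrite -[LHS]trace_mx11 -mxtrace_tr trace_mx11.
by rewrite !trmx_mul trmxK symA mulmxA.
Qed.

Lemma qformDZ (R : realType) (n : nat) (A : 'M[R]_n) (t : R)
    (u v : 'cV[R]_n) : A \is symmetricmx ->
  qform A (u + t *: v)
    = qform A u + 2 * t * (u^T *m A *m v) 0 0 + t ^+ 2 * qform A v.
Proof.
move=> symA; rewrite /qform [(u + _)^T]linearD /= [(t *: v)^T]linearZ /=.
rewrite !mulmxDl !mulmxDr -!scalemxAl -!scalemxAr.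
have := symmetric_bilinC _ _ _ u v symA.
have addE (B C : 'M[R]_1) : (B + C) 0 0 = B 0 0 + C 0 0 by rewrite mxE.
have scaleE a (B : 'M[R]_1) : (a *: B) 0 0 = a * B 0 0 by rewrite mxE.
rewrite !(addE, scaleE) => ->.
by ring.
Qed.

Lemma bilin_delta (R : realType) (n : nat) (A : 'M[R]_n) (i j : 'I_n) :
  ((delta_mx i 0 : 'cV[R]_n)^T *m A *m (delta_mx j 0 : 'cV[R]_n)) 0 0 = A i j.
Proof. by rewrite trmx_delta -rowE -colE !mxE. Qed.

Lemma qform_delta (R : realType) (n : nat) (A : 'M[R]_n) (i : 'I_n) :
  qform A (delta_mx i 0) = A i i.
Proof. exact: bilin_delta. Qed.

Lemma psdmx_diag_ge0 (R : realType) (n : nat) (A : 'M[R]_n) (i : 'I_n) :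
  psdmx A -> 0 <= A i i.
Proof. by case=> _ /(_ (delta_mx i 0)); rewrite qform_delta. Qed.

(** With A j j = 0, the form on e_i + t e_j is affine in t with slope 2 A i j;
    being nonnegative for every t, it has slope zero. *)
Lemma psdmx_diag0_col0 (R : realType) (n : nat) (A : 'M[R]_n) (i j : 'I_n) :
  psdmx A -> A j j = 0 -> A i j = 0.
Proof.
move=> [symA A_ge0] Ajj0; apply/eqP/negPn/negP => Aij_neq0.
(* This t makes the affine function of t equal to -1. *)
have := A_ge0 (delta_mx i 0 + (- ((A i i + 1) / (2 * A i j))) *: delta_mx j 0).
rewrite qformDZ// !qform_delta bilin_delta Ajj0.
have -> : A i i + 2 * - ((A i i + 1) / (2 * A i j)) * A i j
    + (- ((A i i + 1) / (2 * A i j))) ^+ 2 * 0 = -1 by field.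
by rewrite lerNr oppr0 ler10.
Qed.

(** The form of the new matrix at z is the minimum of the form of A along the
    line z + R u, which is where the square is completed. *)
Lemma psdmx_deflate (R : realType) (n : nat) (A : 'M[R]_n) (u : 'cV[R]_n) :
  psdmx A -> 0 < qform A u ->
  psdmx (A - (qform A u)^-1 *: ((A *m u) *m (A *m u)^T)).
Proof.
move=> [symA A_ge0] q_gt0; split.
  apply/symmetricmxP; rewrite linearB linearZ /= trmx_mul trmxK.
  by move/symmetricmxP: symA => ->.
move=> z; set q := qform A u in q_gt0 *; set b := (z^T *m A *m u) 0 0.
suff -> : qform (A - q^-1 *: ((A *m u) *m (A *m u)^T)) z
    = qform A (z + (- (b / q)) *: u) by exact: A_ge0.
have -> : qform (A - q^-1 *: ((A *m u) *m (A *m u)^T)) z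
    = qform A z - q^-1 * b ^+ 2.
  rewrite /qform mulmxBr mulmxBl -scalemxAr -scalemxAl.
  have -> : z^T *m (A *m u *m (A *m u)^T) *m z
      = (z^T *m A *m u) *m (z^T *m A *m u)^T.
    by rewrite !trmx_mul trmxK !mulmxA.
  rewrite [LHS]mxE; congr (_ + _); rewrite mxE; congr (- _).
  by rewrite mxE; congr (_ * _); rewrite mxE big_ord1 [_^T _ _]mxE expr2.
rewrite qformDZ// -/b -/q; field.
by rewrite gt_eqF.
Qed.

(** Induction on the number of nonzero diagonal entries.  Deflating along e_i
    kills the i-th one, and no zero entry becomes nonzero: the diagonal can
    only decrease and stays nonnegative. *)
Lemma psdmx_sum_outer (R : realType) (n : nat) (A : 'M[R]_n) :
  psdmx A -> exists s : seq 'cV[R]_n, A = \sum_(v <- s) v *m v^T.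
Proof.
have [m] := ubnP #|[set i | A i i != 0]|%SET.
elim: m => // m IHm in A *; rewrite ltnS => card_le psdA.
have [[i Aii_neq0]|diag0] := pselect (exists i, A i i != 0); last first.
  exists [::]; rewrite big_nil; apply/matrixP => i j; rewrite mxE.
  apply: psdmx_diag0_col0 => //; apply/eqP/negPn/negP => Ajj_neq0.
  by apply: diag0; exists j.
have Aii_gt0 : 0 < A i i by rewrite lt_def Aii_neq0 psdmx_diag_ge0.
pose u : 'cV[R]_n := delta_mx i 0.
pose w := A *m u; pose B := A - (A i i)^-1 *: (w *m w^T).
have qu : qform A u = A i i by exact: qform_delta.
have psdB : psdmx B by rewrite /B -qu; apply: psdmx_deflate; rewrite ?qu.
have diagB j : B j j = A j j - (A i i)^-1 * A j i ^+ 2.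
  by rewrite /B /w /u -colE !mxE big_ord1 !mxE expr2.
have Bii0 : B i i = 0 by rewrite diagB expr2 mulKf// subrr.
have B_le j : B j j <= A j j.
  by rewrite diagB gerBl mulr_ge0 ?sqr_ge0// invr_ge0 ltW.
have [|s Bs] := IHm B _ psdB.
  apply: leq_trans card_le; apply: proper_card; apply/properP; split.
    apply/fintype.subsetP => j; rewrite !inE; apply: contra_neq => Ajj0.
    by apply/le_anti; rewrite psdmx_diag_ge0// andbT -Ajj0.
  by exists i; rewrite !inE ?Aii_neq0// Bii0 eqxx.
exists ((Num.sqrt (A i i))^-1 *: w :: s); rewrite big_cons -Bs /B.
rewrite [(_ *: w)^T]linearZ /= -scalemxAl -scalemxAr scalerA -expr2 exprVn.
by rewrite sqr_sqrtr ?psdmx_diag_ge0// addrC subrK.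
Qed.

Lemma mxtrace_mul_outer (R : realType) (n : nat) (A : 'M[R]_n)
    (v : 'cV[R]_n) : \tr (A *m (v *m v^T)) = qform A v.
Proof. by rewrite mulmxA mxtrace_mulC trace_mx11 mulmxA. Qed.

Lemma psdmx_trace_mul_ge0 (R : realType) (n : nat) (A B : 'M[R]_n) :
  psdmx A -> psdmx B -> 0 <= \tr (A *m B).
Proof.
move=> [_ A_ge0] /psdmx_sum_outer[s ->].
rewrite mulmx_sumr raddf_sum /=; apply: sumr_ge0 => v _.
by rewrite mxtrace_mul_outer.
Qed.

Lemma nsdmxN (R : realType) (n : nat) (A : 'M[R]_n) :
  nsdmx A -> psdmx (- A).
Proof.
move=> [/symmetricmxP symA A_le0]; split.
  by apply/symmetricmxP; rewrite linearN /= symA.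
by move=> x; rewrite /qform mulmxN mulNmx mxE oppr_ge0; exact: A_le0.
Qed.

Lemma qsdp_objectiveE (R : realType) (n : nat) (Q Qp X : 'M[R]_n)
    (x : 'cV[R]_n) :
  qform (Q - Qp) x + \tr (Qp *m X)
    = \tr (Q *m X) + \tr ((- (Q - Qp)) *m (X - x *m x^T)).
Proof.
rewrite mulNmx mulmxBr opprB [\tr (_ - _)]linearB /= mxtrace_mul_outer.
by rewrite mulmxBl [\tr (_ - _)]linearB /=; ring.
Qed.

Lemma p_LSDP_le_QSDP (R : realType) (n : nat) (Q Qp : 'M[R]_n)
    (F : set ('cV[R]_n * 'M[R]_n)) :
  nsdmx (Q - Qp) -> (p_LSDP Q F <= p_QSDP Q F Qp)%E.
Proof.
move=> nsdN; apply: ge_ereal_sup => _ [p feas_p <-].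
apply: (@le_trans _ _ (qform (Q - Qp) p.1 + \tr (Qp *m p.2))%:E).
  rewrite lee_fin qsdp_objectiveE lerDl.
  by apply: psdmx_trace_mul_ge0; [exact: nsdmxN | case: feas_p].
by apply: ereal_sup_ubound; exists p.
Qed.

Lemma p_QSDP_id (R : realType) (n : nat) (Q : 'M[R]_n)
    (F : set ('cV[R]_n * 'M[R]_n)) : p_QSDP Q F Q = p_LSDP Q F.
Proof.
rewrite /p_QSDP /p_LSDP; congr ereal_sup; apply: eq_imagel => p _.
by rewrite qsdp_objectiveE subrr oppr0 mul0mx mxtrace0 addr0.
Qed.

Lemma qsdp_param_id (R : realType) (n : nat) (Q : 'M[R]_n) :
  Q \is symmetricmx -> qsdp_param Q Q.
Proof.
move=> symQ; split=> //; rewrite subrr; split=> [|x].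
  by apply/symmetricmxP; rewrite trmx0.
by rewrite /qform mulmx0 mul0mx mxE.
Qed.

Theorem theorem2 (R : realType) (n : nat) (Q : 'M[R]_n)
    (F : set ('cV[R]_n * 'M[R]_n))
    (Qsym : Q \is symmetricmx)
    (Fsym : forall (x : 'cV[R]_n) (X : 'M[R]_n), F (x, X) -> X \is symmetricmx) :
  (forall Qp : 'M[R]_n, Qp \is symmetricmx -> nsdmx (Q - Qp) ->
     (p_LSDP Q F <= p_QSDP Q F Qp)%E) /\
  ereal_inf [set p_QSDP Q F Qp | Qp in qsdp_param Q] = p_LSDP Q F.
Proof.
split=> [Qp _|]; first exact: p_LSDP_le_QSDP.
apply/le_anti/andP; split; last first.
  by apply: le_ereal_inf_tmp => _ [Qp [_ nsdN] <-]; exact: p_LSDP_le_QSDP.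
by rewrite -[leRHS]p_QSDP_id; apply: ereal_inf_lbound; exists Q;
  [exact: qsdp_param_id|].
Qed.
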